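(* Let $\mathbb{F}\in\{\mathbb{R},\mathbb{C}\}$, let $n,m\geq 2$ be integers, let $p\in\{1,\infty\}$, and let $T:\mathcal{L}(\ell_p^n,\ell_p^m)\to\mathcal{L}(\ell_p^n,\ell_p^m)$ be a non-zero linear map. Then the following are equivalent. (1) $T$ preserves TEA pairs. (2) $T$ preserves parallel pairs and $\operatorname{rank}(T)>1$. (3) $T$ preserves parallel pairs and $T$ is invertible. (4) $T$ is a scalar multiple of an isometry.
   Context: All spaces are over $\mathbb{F}$; $\mathbb{T}=\{\mu\in\mathbb{F}:|\mu|=1\}$. $\ell_p^n$ is $\mathbb{F}^n$ with the $p$-norm, and $\mathcal{L}(\ell_p^n,\ell_p^m)$ is the space of all linear operators from $\ell_p^n$ to $\ell_p^m$ with the operator norm. Two vectors $x,y$ of a Banach space form a TEA (triangle equality attaining) pair if $\|x+y\|=\|x\|+\|y\|$; they are parallel (form a parallel pair), written $x\parallel y$, if there exists $\lambda\in\mathbb{T}$ with $\|x+\lambda y\|=\|x\|+\|y\|$. A linear map $T:\mathcal{X}\to\mathcal{X}$ preserves parallel (resp. TEA) pairs if $T(x),T(y)$ form a parallel (resp. TEA) pair whenever $x,y\in\mathcal{X}$ form a parallel (resp. TEA) pair. An isometry here is a linear map $U$ with $\|U(x)\|=\|x\|$ for all $x$, and $\operatorname{rank}(T)$ is the dimension of the range of $T$. *)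

(* Defs.v *)
From HB Require Import structures.
From mathcomp Require Import all_boot all_order all_algebra.
From mathcomp Require Import all_classical all_reals all_analysis.
From mathcomp Require Import complex.

Set Implicit Arguments.
Unset Strict Implicit.
Unset Printing Implicit Defensive.

Import Order.TTheory GRing.Theory Num.Theory.
Local Open Scope classical_set_scope.
Local Open Scope ring_scope.

Variant scalar_kind := RealScalars | ComplexScalars.

Definition scalar_field (R : realType) (k : scalar_kind) : numFieldType :=
  match k with
  | RealScalars => R
  | ComplexScalars => R[i]%C
  end.

(* The canonical norm of R[i] is R[i]-valued; this modulus is R-valued, so that
   suprema of norms make sense for both choices of scalars. *)
Definition modulus (R : realType) (k : scalar_kind) : scalar_field R k -> R :=
  match k return scalar_field R k -> R with
  | RealScalars => fun x => `|x|
  | ComplexScalars => fun z => Normc.normc z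
  end.

Section Norms.
Variables (R : realType) (k : scalar_kind).
Local Notation F := (scalar_field R k).

(* Meaningful for 1 <= p; the value at -oo is junk. *)
Definition lpnorm (p : \bar R) (n : nat) (x : 'cV[F]_n) : R :=
  match p with
  | r%:E => (\sum_(i < n) modulus (x i 0) `^ r) `^ r^-1
  | +oo%E => \big[Num.max/0]_(i < n) modulus (x i 0)
  | -oo%E => 0
  end.

Definition opnorm (p : \bar R) (n m : nat) (A : 'Hom('cV[F]_n, 'cV[F]_m)) : R :=
  sup [set lpnorm p (A x) | x in [set x | lpnorm p x <= 1]].

Section Pairs.
Variables (V : lmodType F) (N : V -> R).

Definition TEA_pair (x y : V) : Prop := N (x + y) = N x + N y.

Definition parallel_pair (x y : V) : Prop :=
  exists2 lambda : F, modulus lambda = 1 & N (x + lambda *: y) = N x + N y.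

Definition preserves_pairs (E : V -> V -> Prop) (T : V -> V) : Prop :=
  forall x y, E x y -> E (T x) (T y).

Definition norm_isometry (U : V -> V) : Prop := forall x, N (U x) = N x.

End Pairs.
End Norms.

Arguments opnorm {R k} p {n m} A.

(* Main.v *)
(** For p = 1 (resp. p = oo) the operator norm of a matrix is the largest
l1-norm of a column (resp. row), so everything takes place in oo-sums of
l1-spaces.  Put M x = N (T x).  If x and y attain the triangle equality for N,
then T x and T y are parallel, and a functional supporting them pulls back to a
linear f with |f| <= M that attains M at both x and y.

Let x be supported in one row and z off that row, with N z <= N x.  The vectors
x + t z, |t| <= 1, pairwise attain the triangle equality, and this forces
M (x + t z) = |p + q t| on the unit disc.  If all the slopes q vanish, then
M (x + z) = M x throughout, and comparing different rows gives M = c N.  A nonzero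
slope q pins down the phase of every supporting functional, so that p depends
additively on x; as each row has two independent directions, M then vanishes on
some nonzero w in a single row.  Finally, if T w = 0 with T z <> 0 for some z off
that row, then the disc s + C w + t z, C large, must meet the kernel of T for every
s, so that T has rank one. *)

Require Import Defs.
From mathcomp Require Import all_boot all_order all_algebra.
From mathcomp Require Import all_classical all_reals all_analysis.
From mathcomp Require Import complex.
From mathcomp Require Import ring lra.

Set Implicit Arguments.
Unset Strict Implicit.
Unset Printing Implicit Defensive.

Import Order.TTheory GRing.Theory Num.Theory.
Import numFieldNormedType.Exports.
Local Open Scope ring_scope.

(** * Scalars *)

Section Scalars.
Variables (R : realType) (k : scalar_kind).
Local Notation F := (scalar_field R k).
Implicit Types x y : F.

(** With imaginary part 0 and trivial conjugation over the reals, both fields are treated at once: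
    identities between scalars become real polynomial identities in the two parts. *)
Definition scalar_re : F -> R :=
  match k return scalar_field R k -> R with
  | RealScalars => fun r => r
  | ComplexScalars => fun z => complex.Re z
  end.

Definition scalar_im : F -> R :=
  match k return scalar_field R k -> R with
  | RealScalars => fun=> 0
  | ComplexScalars => fun z => complex.Im z
  end.

Definition scalar_conj : F -> F :=
  match k return scalar_field R k -> scalar_field R k with
  | RealScalars => fun r => r
  | ComplexScalars => fun z => conjc z
  end.

Definition of_real : R -> F :=
  match k return R -> scalar_field R k with
  | RealScalars => fun r => r
  | ComplexScalars => fun r => (r%:C)%C
  end.

Lemma scalar_eqP x y :
  scalar_re x = scalar_re y -> scalar_im x = scalar_im y -> x = y.
Proof.
by rewrite /scalar_re /scalar_im; case: k x y => [//|[a b] [c d]] /= -> ->.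
Qed.

Lemma scalar_reD x y : scalar_re (x + y) = scalar_re x + scalar_re y.
Proof. by rewrite /scalar_re; case: k x y => [//|[a b] [c d]]. Qed.

Lemma scalar_imD x y : scalar_im (x + y) = scalar_im x + scalar_im y.
Proof.
by rewrite /scalar_im; case: k x y => [x y|[a b] [c d]] //=; rewrite addr0.
Qed.

Lemma scalar_reN x : scalar_re (- x) = - scalar_re x.
Proof. by rewrite /scalar_re; case: k x => [//|[a b]]. Qed.

Lemma scalar_imN x : scalar_im (- x) = - scalar_im x.
Proof. by rewrite /scalar_im; case: k x => [x|[a b]] //=; rewrite oppr0. Qed.

Lemma scalar_reM x y :
  scalar_re (x * y) = scalar_re x * scalar_re y - scalar_im x * scalar_im y.
Proof.
rewrite /scalar_re /scalar_im; case: k x y => [x y|[a b] [c d]] //=.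
by rewrite mulr0 subr0.
Qed.

Lemma scalar_imM x y :
  scalar_im (x * y) = scalar_re x * scalar_im y + scalar_im x * scalar_re y.
Proof.
rewrite /scalar_re /scalar_im; case: k x y => [x y|[a b] [c d]] //=.
by rewrite mulr0 mul0r addr0.
Qed.

Lemma scalar_reJ x : scalar_re (scalar_conj x) = scalar_re x.
Proof. by rewrite /scalar_re /scalar_conj; case: k x => [//|[a b]]. Qed.

Lemma scalar_imJ x : scalar_im (scalar_conj x) = - scalar_im x.
Proof.
by rewrite /scalar_im /scalar_conj; case: k x => [x|[a b]] //=; rewrite oppr0.
Qed.

Lemma re_of_real r : scalar_re (of_real r) = r.
Proof. by rewrite /scalar_re /of_real; case: k. Qed.

Lemma im_of_real r : scalar_im (of_real r) = 0.
Proof. by rewrite /scalar_im /of_real; case: k. Qed.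

Lemma scalar_re0 : scalar_re 0 = 0.
Proof. by rewrite /scalar_re; case: k. Qed.

Lemma scalar_im0 : scalar_im 0 = 0.
Proof. by rewrite /scalar_im; case: k. Qed.

Lemma scalar_re1 : scalar_re 1 = 1.
Proof. by rewrite /scalar_re; case: k. Qed.

Lemma scalar_im1 : scalar_im 1 = 0.
Proof. by rewrite /scalar_im; case: k. Qed.

Definition scalarE := (scalar_reD, scalar_imD, scalar_reN, scalar_imN,
  scalar_reM, scalar_imM, scalar_reJ, scalar_imJ, re_of_real, im_of_real,
  scalar_re0, scalar_im0, scalar_re1, scalar_im1).

Lemma modulus_sqrt x :
  modulus x = Num.sqrt (scalar_re x ^+ 2 + scalar_im x ^+ 2).
Proof.
rewrite /modulus /scalar_re /scalar_im; case: k x => [x|[a b]] //=.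
by rewrite expr0n addr0 sqrtr_sqr.
Qed.

Lemma modulus_sqr x : modulus x ^+ 2 = scalar_re x ^+ 2 + scalar_im x ^+ 2.
Proof. by rewrite modulus_sqrt sqr_sqrtr // addr_ge0 ?sqr_ge0. Qed.

Lemma modulus_ge0 x : 0 <= modulus x.
Proof. by rewrite modulus_sqrt sqrtr_ge0. Qed.

Lemma le_modulus x y : (modulus x <= modulus y) =
  (scalar_re x ^+ 2 + scalar_im x ^+ 2 <= scalar_re y ^+ 2 + scalar_im y ^+ 2).
Proof. by rewrite -!modulus_sqr ler_sqr ?nnegrE ?modulus_ge0. Qed.

Lemma modulusM x y : modulus (x * y) = modulus x * modulus y.
Proof.
apply/eqP; rewrite -(@eqrXn2 _ 2) ?mulr_ge0 ?modulus_ge0 // exprMn !modulus_sqr.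
by rewrite !scalarE; apply/eqP; ring.
Qed.

Lemma modulus0 : modulus (0 : F) = 0.
Proof. by rewrite modulus_sqrt !scalarE expr0n addr0 sqrtr0. Qed.

Lemma modulus1 : modulus (1 : F) = 1.
Proof. by rewrite modulus_sqrt !scalarE expr0n addr0 expr1n sqrtr1. Qed.

Lemma modulusN x : modulus (- x) = modulus x.
Proof. by rewrite !modulus_sqrt !scalarE !sqrrN. Qed.

Lemma modulusJ x : modulus (scalar_conj x) = modulus x.
Proof. by rewrite !modulus_sqrt !scalarE !sqrrN. Qed.

Lemma modulus_of_real r : modulus (of_real r) = `|r|.
Proof. by rewrite modulus_sqrt !scalarE expr0n addr0 sqrtr_sqr. Qed.

Lemma modulus_eq0 x : (modulus x == 0) = (x == 0).
Proof.
apply/eqP/eqP => [mx0|->]; last exact: modulus0.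
have: modulus x ^+ 2 == 0 by rewrite mx0 expr0n.
rewrite modulus_sqr paddr_eq0 ?sqr_ge0 // !sqrf_eq0 => /andP[/eqP rx /eqP ix].
by apply: scalar_eqP; rewrite !scalarE.
Qed.

Lemma modulus_gt0 x : (0 < modulus x) = (x != 0).
Proof. by rewrite lt_def modulus_eq0 modulus_ge0 andbT. Qed.

Lemma re_le_modulus x : scalar_re x <= modulus x.
Proof.
apply: le_trans (ler_norm _) _; rewrite -ler_sqr ?nnegrE ?modulus_ge0 //.
by rewrite modulus_sqr real_normK ?num_real // lerDl sqr_ge0.
Qed.

Lemma modulusD x y : modulus (x + y) <= modulus x + modulus y.
Proof.
rewrite -ler_sqr ?nnegrE ?addr_ge0 ?modulus_ge0 // modulus_sqr !scalarE.
have := re_le_modulus (x * scalar_conj y).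
rewrite modulusM modulusJ !scalarE => xy.
have := modulus_sqr x; have := modulus_sqr y; lra.
Qed.

Lemma modulus_double x : modulus (x + x) = modulus x + modulus x.
Proof.
rewrite -[RHS]mulr2n -mulr_natl -[2%:R]ger0_norm // -modulus_of_real -modulusM.
by congr modulus; apply: scalar_eqP; rewrite !scalarE; ring.
Qed.

Lemma modulus_sum (I : finType) (f : I -> F) :
  modulus (\sum_i f i) <= \sum_i modulus (f i).
Proof.
elim/big_ind2: _ => [|a u b v au bv|//]; first by rewrite modulus0.
by apply: le_trans (modulusD _ _) _; rewrite lerD.
Qed.

Lemma modulusV x : modulus x^-1 = (modulus x)^-1.
Proof.
have [->|x0] := eqVneq x 0; first by rewrite invr0 modulus0 invr0.
by apply: (@mulfI _ (modulus x)); rewrite -?modulusM ?divff ?modulus1 ?modulus_eq0.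
Qed.

Lemma of_realD r s : of_real (r + s) = of_real r + of_real s.
Proof. by apply: scalar_eqP; rewrite !scalarE; ring. Qed.

Lemma of_real_eq0 r : (of_real r == 0) = (r == 0).
Proof. by rewrite -modulus_eq0 modulus_of_real normr_eq0. Qed.

Lemma modulus_phase x : exists2 u : F, modulus u = 1 & u * x = of_real (modulus x).
Proof.
have [->|x0] := eqVneq x 0.
  by exists 1; rewrite ?modulus1 // mulr0 modulus0; apply: scalar_eqP; rewrite !scalarE.
have mx0 : modulus x != 0 by rewrite modulus_eq0.
exists (of_real (modulus x)^-1 * scalar_conj x).
  by rewrite modulusM modulus_of_real modulusJ ger0_norm ?mulVf ?invr_ge0 ?modulus_ge0.
have := modulus_sqr x => e.
apply: scalar_eqP; rewrite !scalarE; last by ring.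
apply: (@mulfI _ (modulus x)) => //; rewrite -expr2 e; field.
exact: mx0.
Qed.

Lemma modulus1_neq0 x : modulus x = 1 -> x != 0.
Proof. by move=> x1; rewrite -modulus_eq0 x1 oner_eq0. Qed.

End Scalars.

(** The circle is {1, -1} over the reals. Over the complex numbers it is the union of two graphs
    over [-1, 1]; [u], being Lipschitz, is continuous along each, and the larger of the two maxima
    is taken. *)
Lemma real_max_modulus1 (R : realType) (k : scalar_kind)
    (u : scalar_field R k -> R) (K : R) :
    (forall s t, u s - u t <= K * modulus (s - t)) ->
  exists2 t0, modulus t0 = 1 & forall t, modulus t = 1 -> u t <= u t0.
Proof.
case: k u => u lip_u; last pose C := scalar_field R ComplexScalars.
  exists (if u 1 <= u (- 1) then - 1 else 1).
    by case: ifP; rewrite ?modulusN modulus1.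
  move=> t /= t1; have : t = 1 \/ t = -1.
    suff : (t == 1) || (t == -1) by case/orP => /eqP; [left|right].
    by rewrite -eqf_sqr expr1n -(real_normK (num_real t)) t1 expr1n.
  by case=> ->; case: ifP => // /negbT; rewrite -ltNge => /ltW.
have K0 : 0 <= K.
  by have := lip_u 1 0; have := lip_u 0 1; rewrite sub0r subr0 modulusN modulus1; lra.
(* The square root of a negative number is 0, so [sq] is continuous on the whole line and not only
   on [-1, 1]. *)
pose sq (a : R) : R := Num.sqrt (1 - a ^+ 2).
have sq_cont : continuous sq.
  move=> a; apply: continuous_comp; last exact: sqrt_continuous.
  by apply: cvgB; [exact: cvg_cst|apply: cvgM; exact: cvg_id].
have arc_max (b : bool) : exists2 c, c \in `[-1, 1] & forall a, a \in `[-1, 1] ->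
    u (a +i* ((-1) ^+ b * sq a))%C <= u (c +i* ((-1) ^+ b * sq c))%C.
  apply: EVT_max; first lra.
  apply: continuous_subspaceT => a; apply/cvgrPdist_lt => e e0.
  (* Both coordinates move by less than this bound, so [u] moves by at most e K / (K + 1); K + 1
     keeps the denominator positive when K = 0. *)
  have e'0 : 0 < e / (2 * (K + 1)) by rewrite divr_gt0 // mulr_gt0 //; lra.
  have eE : e / (2 * (K + 1)) * (2 * (K + 1)) = e by rewrite divfK //; lra.
  near=> c.
  have ac : `|a - c| < e / (2 * (K + 1)).
    by near: c; exact: (@nbhsx_ballx _ _ a _ e'0).
  have sac : `|sq a - sq c| < e / (2 * (K + 1)).
    by near: c; move/cvgrPdist_lt: (sq_cont a) => /(_ _ e'0).
  have mle (x y : R) : modulus ((x +i* y)%C : C) <= `|x| + `|y|.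
    rewrite -ler_sqr ?nnegrE ?addr_ge0 ?modulus_ge0 // modulus_sqr /=.
    rewrite -(real_normK (num_real x)) -(real_normK (num_real y)).
    have : 0 <= `|x| * `|y| by rewrite mulr_ge0.
    by lra.
  have dist (x y : R) : `|x - y| < e / (2 * (K + 1)) ->
      `|sq x - sq y| < e / (2 * (K + 1)) ->
      u (x +i* ((-1) ^+ b * sq x))%C - u (y +i* ((-1) ^+ b * sq y))%C < e.
    move=> xy sxy; apply: le_lt_trans (lip_u _ _) _.
    have : K * modulus ((x +i* ((-1) ^+ b * sq x) - y +i* ((-1) ^+ b * sq y))%C : C)
        <= K * (`|x - y| + `|sq x - sq y|).
      rewrite ler_wpM2l // (le_trans (mle _ _)) //.
      by rewrite -mulrBr normrM normrX normrN1 expr1n mul1r.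
    have : K * (`|x - y| + `|sq x - sq y|) <= K * (e / (2 * (K + 1)) * 2).
      by rewrite ler_wpM2l //; lra.
    by lra.
  by rewrite ltr_norml ltrNl opprB !dist // distrC.
have [c cI cmax] := arc_max false; have [d dI dmax] := arc_max true.
rewrite expr0 in cmax; rewrite expr1 in dmax.
have on_circle (a : R) (b : bool) : a \in `[-1, 1] ->
    modulus ((a +i* ((-1) ^+ b * sq a))%C : C) = 1.
  move=> aI; have /andP[a1 a2] : -1 <= a <= 1 by move: aI; rewrite in_itv.
  have a3 : 0 <= 1 - a ^+ 2.
    by rewrite subr_ge0 -(real_normK (num_real a)) expr_le1 // ler_norml a1.
  rewrite modulus_sqrt /= exprMn sqr_sqrtr // sqrr_sign mul1r addrC subrK.
  exact: sqrtr1.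
have arcs (t : C) : modulus t = 1 -> exists2 a, a \in `[-1, 1] &
    t = (a +i* sq a)%C \/ t = (a +i* (-1 * sq a))%C.
  case: t => a b t1; exists a.
    have := re_le_modulus ((a +i* b)%C : C).
    have := re_le_modulus (- (a +i* b)%C : C).
    by rewrite modulusN t1 in_itv /=; lra.
  have := modulus_sqr ((a +i* b)%C : C).
  rewrite t1 expr1n /= => /eqP ; rewrite addrC -subr_eq => /eqP e.
  rewrite /sq e sqrtr_sqr; case: (ger0P b) => _; [left|right] => //.
  by rewrite mulN1r opprK.
have [uc|/ltW uc] := leP (u (d +i* (-1 * sq d))%C) (u (c +i* (1 * sq c))%C).
  exists (c +i* (1 * sq c))%C; first exact: (on_circle c false).
  move=> t /arcs[a aI [] ->].
    by have := cmax _ aI; rewrite mul1r.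
  exact: le_trans (dmax _ aI) uc.
exists (d +i* (-1 * sq d))%C; first exact: (on_circle d true).
move=> t /arcs[a aI [] ->]; last exact: dmax.
by apply: le_trans uc; have := cmax _ aI; rewrite mul1r.
Unshelve. all: by end_near.
Qed.

(** * Moduli of affine functions *)

Section Plane.
Variables (R : realType) (k : scalar_kind).
Local Notation F := (scalar_field R k).
Implicit Types p q t : F.

(** After a rotation p = p0, and [d] is the difference of the slopes. If [d] were non-zero, moving t
    in the direction of p0 times the conjugate of [d] would raise the left modulus above the right
    one to first order. *)
Lemma tangent_affine p q p0 q0 (e : R) :
    p0 != 0 -> 0 < e -> modulus p = modulus p0 ->
    (forall t, modulus t <= e -> modulus (p + q * t) <= modulus (p0 + q0 * t)) ->
  exists2 v : F, modulus v = 1 & p = v * p0 /\ q = v * q0.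
Proof.
move=> p0n e0 pp0 le_pq.
have mp0 : modulus p0 != 0 by rewrite modulus_eq0.
have pn : p != 0 by rewrite -modulus_eq0 pp0.
have cancel (K : fieldType) (x y z : K) :
    x != 0 -> y != 0 -> z = x / y * (z * y / x).
  by move=> x0 y0; field; rewrite x0 y0.
exists (p / p0); first by rewrite modulusM modulusV pp0 divff.
split; first by rewrite divfK.
pose d := q * p0 / p - q0.
suff d0 : d = 0.
  by move/subr0_eq: d0 => <-; apply: cancel.
apply/eqP; apply: contraT => dn.
have dgt : 0 < modulus d by rewrite modulus_gt0.
have pgt : 0 < modulus p0 by rewrite modulus_gt0.
(* This size gives |t| <= e for the t below, and h |q0|^2 < 1, so that the second-order term cannot
   cancel the first-order one. *)
pose h := e / (modulus p0 * modulus d + e * (modulus q0 ^+ 2 + 1)).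
have q0ge := sqr_ge0 (modulus q0).
have den : 0 < modulus p0 * modulus d + e * (modulus q0 ^+ 2 + 1).
  by rewrite addr_gt0 ?mulr_gt0 // ltr_wpDl.
have h0 : 0 < h by rewrite divr_gt0.
have hE : h * (modulus p0 * modulus d + e * (modulus q0 ^+ 2 + 1)) = e.
  by rewrite divfK // gt_eqF.
clearbody h.
have hpd : 0 <= h * modulus p0 * modulus d by rewrite !mulr_ge0 ?modulus_ge0 // ltW.
have heq : 0 <= h * e * modulus q0 ^+ 2 
  by apply: mulr_ge0 => //; apply: mulr_ge0; exact: ltW.
have he : 0 < h * e by rewrite mulr_gt0.
pose t := of_real k h * p0 * scalar_conj d.
have mt : modulus t = h * modulus p0 * modulus d.
  by rewrite !modulusM modulus_of_real modulusJ ger0_norm // ltW.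
have te : modulus t <= e by rewrite mt; lra.
have := le_pq t te.
have -> : p + q * t = p / p0 * (p0 + (d + q0) * t).
  by rewrite /d subrK mulrDr divfK // mulrA -cancel.
rewrite modulusM modulusM modulusV pp0 divff // mul1r.
rewrite le_modulus.
have hq : h * modulus q0 ^+ 2 < 1.
  by rewrite -(ltr_pM2r e0) mul1r; lra.
have key : scalar_re (p0 + (d + q0) * t) ^+ 2 + scalar_im (p0 + (d + q0) * t) ^+ 2
  - (scalar_re (p0 + q0 * t) ^+ 2 + scalar_im (p0 + q0 * t) ^+ 2)
  = h * modulus p0 ^+ 2 * modulus d ^+ 2 * 
     (2 + h * (modulus (d + q0) ^+ 2 - modulus q0 ^+ 2)).
  by rewrite !modulus_sqr /t !scalarE; ring.
rewrite -subr_le0 key leNgt => /negP[].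
rewrite !mulr_gt0 ?exprn_gt0 //.
have : 0 <= h * modulus (d + q0) ^+ 2 by rewrite mulr_ge0 ?sqr_ge0 // ltW.
lra.
Qed.

(** Squared and added, the first two inequalities say that the real inner product of a and b + b' is
    non-negative. Moving from a by half of b + b' then raises the squared modulus by at least |b +
    b'|^2 / 4. *)
Lemma midpoint_modulus (a b b' : F) :
  modulus (a - b) <= modulus (a + b') -> modulus (a - b') <= modulus (a + b) ->
  modulus (a + of_real k 2^-1 * (b + b')) <= modulus a -> b + b' = 0.
Proof.
rewrite !le_modulus => h1 h2 h3.
apply/eqP; rewrite -modulus_eq0 -sqrf_eq0 eq_le sqr_ge0 andbT modulus_sqr.
by move: h1 h2 h3; rewrite !scalarE; lra.
Qed.

(** Rotate p + q onto the non-negative axis: the real parts of the rotated p and q are at most |p|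
    and |q| and have sum |p| + |q|, so both rotated numbers are real and non-negative. *)
Lemma modulusD_eq p q :
    modulus (p + q) = modulus p + modulus q ->
  exists2 v : F, modulus v = 1
    & p = v * of_real k (modulus p) /\ q = v * of_real k (modulus q).
Proof.
have [v v1 vpq] := modulus_phase (p + q) => epq.
have vn := modulus1_neq0 v1.
have := congr1 (@scalar_re R k) vpq; have := congr1 (@scalar_im R k) vpq.
rewrite mulrDr epq => i r.
have mp : modulus (v * p) = modulus p by rewrite modulusM v1 mul1r.
have mq : modulus (v * q) = modulus q by rewrite modulusM v1 mul1r.
have rp := re_le_modulus (v * p); have rq := re_le_modulus (v * q).
rewrite mp in rp; rewrite mq in rq.
rewrite scalar_reD re_of_real in r.
have rp' : scalar_re (v * p) = modulus p by lra.
have rq' : scalar_re (v * q) = modulus q by lra.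
have im z : modulus (v * z) = modulus z -> scalar_re (v * z) = modulus z ->
    scalar_im (v * z) = 0.
  move=> e1 e2; apply/eqP; rewrite -sqrf_eq0; apply/eqP.
  have := modulus_sqr (v * z); rewrite e1 e2; lra.
exists v^-1; first by rewrite modulusV v1 invr1.
by split; apply: (mulfI vn); rewrite mulVKf //; apply: scalar_eqP;
  rewrite ?re_of_real ?im_of_real // im.
Qed.

End Plane.

(** * Functions on the disc supported by moduli of affine functions *)

Section Disc.
Variables (R : realType) (k : scalar_kind).
Local Notation F := (scalar_field R k).
Implicit Types p q t : F.

(* Let U = u(t0) be maximal on the unit circle.  A pair (p, q) supporting u at t0
   and at t0 s is (U - Q, Q) up to a phase, with 0 <= Q <= U.  The value Q0 found
   at s = 0 is the least one.  If Q0 also supports u at s = -1, then it does so on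
   the whole disc; otherwise it does so strictly near 0, and a pair supporting u at
   both 0 and -1 would have to be tangent to |U - Q0 + Q0 s| at 0. *)
Lemma affine_disc (u : F -> R) (K : R) :
    (forall s t, u s - u t <= K * modulus (s - t)) ->
    (forall s t, modulus s <= 1 -> modulus t <= 1 -> exists p q : F,
      [/\ forall w, modulus (p + q * w) <= u w,
          modulus (p + q * s) = u s & modulus (p + q * t) = u t]) ->
  exists p q : F, forall t, modulus t <= 1 -> u t = modulus (p + q * t).
Proof.
move=> lip_u pairs.
have [t0 t01 max_t0] := real_max_modulus1 lip_u.
have t0n := modulus1_neq0 t01.
pose v s := u (t0 * s); pose U := v 1.
(* A pair supporting [v] at its maximum 1 has, up to a phase, non-negative real coefficients with
   sum U; Q stands for its slope. *)
pose g Q s := modulus (of_real k (U - Q) + of_real k Q * s).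
have norming s : modulus s <= 1 -> exists2 Q : R, 0 <= Q <= U &
    (forall w, g Q w <= v w) /\ g Q s = v s.
  move=> s1; have [||p [q [le_u eq1 eqs]]] := pairs t0 (t0 * s).
  - by rewrite t01.
  - by rewrite modulusM t01 mul1r.
  have mq : modulus (q * t0) = modulus q by rewrite modulusM t01 mulr1.
  have pqU : modulus p + modulus q = U.
    apply/eqP; rewrite eq_le; apply/andP; split; last first.
      by rewrite /U /v mulr1 -eq1 -mq modulusD.
    (* At the point b / a of the circle the two terms of p + q t are aligned, so |p| + |q| is
       attained there and is at most U. *)
    have [a a1 ap] := modulus_phase p; have [b b1 bq] := modulus_phase q.
    have an := modulus1_neq0 a1.
    have ba1 : modulus (b / a) = 1 by rewrite modulusM modulusV a1 b1 divr1.
    rewrite /U /v mulr1; apply: le_trans (max_t0 _ ba1); apply: le_trans (le_u _).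
    have abE : a * (p + q * (b / a)) = of_real k (modulus p + modulus q).
      by rewrite mulrDr ap of_realD mulrCA (mulrC a) divfK // (mulrC q) bq.
    rewrite -[leRHS]mul1r -a1 -modulusM abE modulus_of_real ger0_norm //.
    by rewrite addr_ge0 ?modulus_ge0.
  have [c c1 [pE qE]] : exists2 c : F, modulus c = 1 &
      p = c * of_real k (modulus p) /\ q * t0 = c * of_real k (modulus (q * t0)).
    by apply: modulusD_eq; rewrite eq1 mq pqU /U /v mulr1.
  have pqE w : modulus (p + q * (t0 * w)) = g (modulus q) w.
    rewrite mulrA pE qE -mulrA -mulrDr modulusM c1 mul1r mq /g.
    by congr (modulus (of_real k _ + _)); rewrite -pqU addrK.
  exists (modulus q); first by rewrite modulus_ge0 -pqU lerDr modulus_ge0.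
  by split=> [w|]; rewrite -pqE // le_u.
have g_ge0 Q s : 0 <= g Q s by exact: modulus_ge0.
have gB Q Q' s : g Q s ^+ 2 - g Q' s ^+ 2 = (Q - Q') *
    ((Q + Q') * (1 - 2 * scalar_re s + modulus s ^+ 2) - 2 * U * (1 - scalar_re s)).
  by rewrite !modulus_sqr !scalarE; ring.
have g0 Q : 0 <= Q <= U -> g Q 0 = U - Q.
  by move=> /andP[_ QU]; rewrite /g mulr0 addr0 modulus_of_real ger0_norm ?subr_ge0.
have gN1 Q : g Q (-1) = `|U - 2 * Q|.
  rewrite /g mulrN1 -(modulus_of_real k); congr modulus.
  by apply: scalar_eqP; rewrite !scalarE; ring.
have [|Q0 Q0U [leQ0 eqQ0]] := norming 0; first by rewrite modulus0.
have [|Q1 Q1U [leQ1 eqQ1]] := norming (-1); first by rewrite modulusN modulus1.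
have geQ0 Q : 0 <= Q <= U -> (forall w, g Q w <= v w) -> Q0 <= Q.
  by move=> QU /(_ 0); rewrite -eqQ0 !g0 //; lra.
have leQ1N Q : (forall w, g Q w <= v w) -> (U - 2 * Q) ^+ 2 <= (U - 2 * Q1) ^+ 2.
  move=> /(_ (-1)); rewrite -eqQ1 !gN1 => h.
  rewrite -(real_normK (num_real (U - 2 * Q))) -[leRHS]real_normK ?num_real //.
  by rewrite ler_sqr ?nnegrE.
have [Q10|Q01] := leP ((U - 2 * Q1) ^+ 2) ((U - 2 * Q0) ^+ 2).
  exists (of_real k (U - Q0)), (of_real k Q0 / t0) => t t1.
  pose s := t / t0; have tE : t = t0 * s by rewrite mulrC divfK.
  have s1 : modulus s <= 1 by rewrite modulusM modulusV t01 divr1.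
  have [Q QU [leQ eqQ]] := norming _ s1.
  have -> : of_real k Q0 / t0 * t = of_real k Q0 * s.
    by rewrite mulrAC -mulrA.
  rewrite tE -/(v s) -/(g Q0 s); apply/eqP; rewrite eq_le leQ0 andbT -eqQ.
  rewrite -ler_sqr ?nnegrE // -subr_le0 gB.
  have QQ0 := geQ0 _ QU leQ.
  have := le_trans (leQ1N _ leQ) Q10 => QQ.
  have rs := re_le_modulus s.
  have s21 : modulus s ^+ 2 <= 1 by rewrite expr_le1 ?modulus_ge0.
  (* This is the comparison of Q with [Q0] at -1. Writing 1 - 2 Re s + |s|^2 as 2 (1 - Re s) - (1 -
     |s|^2) splits the goal into two terms of known sign. *)
  have h1 : (Q - Q0) * (Q + Q0 - U) <= 0 by lra.
  have h2 : 0 <= (Q - Q0) * (Q + Q0) * (1 - modulus s ^+ 2).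
    by rewrite !mulr_ge0 // ?subr_ge0 //; lra.
  have h3 : 0 <= (1 - scalar_re s) * - ((Q - Q0) * (Q + Q0 - U)).
    by rewrite mulr_ge0 // ?oppr_ge0 // subr_ge0; lra.
  by lra.
exfalso.
have Q0Q1 : Q0 < Q1.
  have := geQ0 _ Q1U leQ1; rewrite le_eqVlt => /orP[/eqP e|//].
  by move: Q01; rewrite e ltxx.
have UQ : U < Q0 + Q1.
  have : 0 < (Q1 - Q0) * (Q0 + Q1 - U) by lra.
  by rewrite pmulr_rgt0 ?subr_gt0.
have S2U : Q0 + Q1 < 2 * U by lra.
have U0 : 0 < U by lra.
have leQ1' Q : (forall w, g Q w <= v w) -> Q <= Q1.
  move=> leQ; rewrite leNgt; apply/negP => Q1Q.
  have := leQ1N _ leQ; have : 0 < (Q - Q1) * (Q + Q1 - U) by rewrite mulr_gt0; lra.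
  by lra.
(* With S = Q0 + Q1 < 2 U, the relation S + 8 U e = 2 U yields S (1 + 3 e) <= 2 U (1 - e), which
   makes the second factor in [gB] non-positive for |w| <= e. *)
pose e := (2 * U - (Q0 + Q1)) / (8 * U).
have e0 : 0 < e by rewrite divr_gt0 // ?mulr_gt0 // subr_gt0.
have eE : e * (8 * U) = 2 * U - (Q0 + Q1) by rewrite divfK // gt_eqF ?mulr_gt0.
clearbody e.
have e1 : e <= 1 by rewrite -(ler_pM2r U0); lra.
have vE w : modulus w <= e -> v w <= g Q0 w.
  move=> we.
  have [|Q QU [leQ eqQ]] := norming w; first exact: le_trans we e1.
  rewrite -eqQ -ler_sqr ?nnegrE // -subr_le0 gB.
  have QQ0 := geQ0 _ QU leQ; have QQ1 := leQ1' _ leQ.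
  apply: mulr_ge0_le0; rewrite ?subr_ge0 // subr_le0.
  have re1 := re_le_modulus w; have re2 := re_le_modulus (- w).
  rewrite modulusN scalar_reN in re2.
  have w2 : modulus w ^+ 2 <= e by rewrite expr2 -[e]mulr1 ler_pM ?modulus_ge0 //; lra.
  have sq_ge0 : 0 <= 1 - 2 * scalar_re w + modulus w ^+ 2.
    have := sqr_ge0 (1 - scalar_re w); have := sqr_ge0 (scalar_im w).
    by rewrite modulus_sqr; lra.
  apply: (@le_trans _ _ ((Q0 + Q1) * (1 + 3 * e))).
    by apply: ler_pM => //; lra.
  have : 0 <= e * (2 * U - (Q0 + Q1)) by rewrite mulr_ge0; lra.
  have : 0 <= U * (e - scalar_re w) by rewrite mulr_ge0; lra.
  lra.
have [||p [q [le_pq eq0 eqN1]]] := pairs (t0 * 0) (t0 * - 1).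
- by rewrite mulr0 modulus0.
- by rewrite modulusM modulusN modulus1 mulr1 t01.
have [c c1 [pE qE]] : exists2 c : F, modulus c = 1 &
    p = c * of_real k (U - Q0) /\ q * t0 = c * of_real k Q0.
  apply: (tangent_affine _ e0).
  - by rewrite of_real_eq0; lra.
  - move: eq0; rewrite -/(v 0) -eqQ0 !mulr0 addr0 /g mulr0 addr0 //.
  - move=> t te; apply: le_trans (vE _ te); rewrite -mulrA; exact: le_pq.
move: eqN1; rewrite -/(v (-1)) -eqQ1 mulrA pE qE -mulrA -mulrDr modulusM c1 mul1r.
rewrite -/(g Q0 (-1)) !gN1 => eN.
by move: Q01; rewrite -(real_normK (num_real (U - 2 * Q0))) eN real_normK ?num_real // ltxx.
Qed.

End Disc.

(** * The mixed row norm *)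

Section RowNorm.
Variables (R : realType) (k : scalar_kind) (a b : nat).
Local Notation F := (scalar_field R k).
Local Notation V := 'M[F]_(a, b).
Implicit Types (u v x z : V) (j : 'I_a).

Definition rowsum v j : R := \sum_i modulus (v j i).

(** The norm of the oo-sum of [a] copies of l1 in dimension [b]. *)
Definition row_norm v : R := \big[Num.max/0]_j rowsum v j.

Definition in_row j x := forall j' i, j' != j -> x j' i = 0.

Definition off_row j z := forall i, z j i = 0.

Lemma rowsum_ge0 v j : 0 <= rowsum v j.
Proof. by apply: sumr_ge0 => i _; exact: modulus_ge0. Qed.

Lemma rowsumD u v j : rowsum (u + v) j <= rowsum u j + rowsum v j.
Proof.
by rewrite -big_split; apply: ler_sum => i _; rewrite mxE modulusD.
Qed.

Lemma rowsumZ c v j : rowsum (c *: v) j = modulus c * rowsum v j.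
Proof. by rewrite mulr_sumr; apply: eq_bigr => i _; rewrite mxE modulusM. Qed.

Lemma rowsum_double v j : rowsum (v + v) j = rowsum v j + rowsum v j.
Proof.
by rewrite /rowsum -big_split; apply: eq_bigr => i _; rewrite mxE modulus_double.
Qed.

(** The midpoint plus u plus v is 3/2 (u + v), whose row sum is known; the triangle inequality then
    removes v. *)
Lemma rowsum_midpoint u v j : rowsum (u + v) j = rowsum u j + rowsum v j ->
  rowsum (of_real k 2^-1 *: (u + v) + u) j =
  rowsum (of_real k 2^-1 *: (u + v)) j + rowsum u j.
Proof.
move=> uv; apply/eqP; rewrite eq_le rowsumD /=.
have : rowsum (of_real k 2^-1 *: (u + v) + u + v) j <=
    rowsum (of_real k 2^-1 *: (u + v) + u) j + rowsum v j by exact: rowsumD.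
have -> : of_real k 2^-1 *: (u + v) + u + v = (of_real k 2^-1 + 1) *: (u + v).
  by rewrite scalerDl scale1r addrA.
have -> : of_real k 2^-1 + 1 = of_real k (3 / 2 : R).
  by apply: (@scalar_eqP R k); rewrite !scalarE; lra.
rewrite !rowsumZ !modulus_of_real !ger0_norm ?divr_ge0 ?invr_ge0 // uv; lra.
Qed.

Lemma rowsum_eq0 v j : rowsum v j = 0 -> off_row j v.
Proof.
move=> /eqP; rewrite psumr_eq0 => [/allP v0 i|i _]; last exact: modulus_ge0.
by have /implyP/(_ isT) := v0 i (mem_index_enum _); rewrite modulus_eq0 => /eqP.
Qed.

Lemma rowsum_off j z : off_row j z -> rowsum z j = 0.
Proof. by move=> z0; apply: big1 => i _; rewrite z0 modulus0. Qed.

Lemma rowsum_in j j' x : in_row j x -> j' != j -> rowsum x j' = 0.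
Proof. by move=> xj jj'; apply: rowsum_off => i; exact: xj. Qed.

Lemma rowsumD_off j u z : off_row j z -> rowsum (u + z) j = rowsum u j.
Proof. by move=> z0; apply: eq_bigr => i _; rewrite mxE z0 addr0. Qed.

Lemma in_rowD j x y : in_row j x -> in_row j y -> in_row j (x + y).
Proof. by move=> xj yj j' i jj'; rewrite mxE xj // yj // addr0. Qed.

Lemma in_rowZ j c x : in_row j x -> in_row j (c *: x).
Proof. by move=> xj j' i jj'; rewrite mxE xj // mulr0. Qed.

Lemma off_rowZ j c z : off_row j z -> off_row j (c *: z).
Proof. by move=> zj i; rewrite mxE zj mulr0. Qed.

Lemma in_row_delta j i : in_row j (delta_mx j i).
Proof. by move=> j' i' jj'; rewrite mxE (negPf jj'). Qed.

Lemma delta_mx_neq0 j i : (delta_mx j i : V) != 0.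
Proof. by apply/eqP => /matrixP/(_ j i)/eqP; rewrite !mxE !eqxx oner_eq0. Qed.

Lemma rowsum_delta c j i : rowsum (c *: (delta_mx j i : V)) j = modulus c.
Proof.
rewrite rowsumZ /rowsum (bigD1 i) //= mxE !eqxx modulus1.
rewrite big1 ?addr0 ?mulr1 // => i' ii'.
by rewrite mxE (negPf ii') andbF modulus0.
Qed.

Lemma rowsum_le_norm v j : rowsum v j <= row_norm v.
Proof. exact: (le_bigmax_cond _ (fun j => rowsum v j)). Qed.

Lemma row_norm_ge0 v : 0 <= row_norm v.
Proof. exact: bigmax_ge_id. Qed.

Lemma row_norm_eq v j :
  (forall j', rowsum v j' <= rowsum v j) -> row_norm v = rowsum v j.
Proof.
move=> vj; apply/eqP; rewrite eq_le rowsum_le_norm andbT.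
by apply/bigmax_leP; split=> //; exact: rowsum_ge0.
Qed.

Lemma row_norm_in j x : in_row j x -> row_norm x = rowsum x j.
Proof.
move=> xj; apply: row_norm_eq => j'; have [->//|jj'] := eqVneq j' j.
by rewrite (rowsum_in xj jj') rowsum_ge0.
Qed.

Lemma row_norm_attained v : (0 < a)%N -> exists j, row_norm v = rowsum v j.
Proof.
move=> a0; have j0 : 'I_a := Ordinal a0.
exists [arg max_(j > j0) rowsum v j]%O.
by case: arg_maxP => // j _ max_j; apply: row_norm_eq => j'; exact: max_j.
Qed.

Lemma row_norm_eq0 v : row_norm v = 0 -> v = 0.
Proof.
move=> v0; apply/matrixP => j i; rewrite mxE; apply: rowsum_eq0 => //.
by apply/eqP; rewrite eq_le rowsum_ge0 andbT -v0 rowsum_le_norm.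
Qed.

Lemma row_normZ c v : row_norm (c *: v) = modulus c * row_norm v.
Proof.
rewrite /row_norm; elim/big_rec2: _ => [|j x y _ ->]; first by rewrite mulr0.
by rewrite rowsumZ maxr_pMr // modulus_ge0.
Qed.

Lemma row_norm_double v : row_norm (v + v) = row_norm v + row_norm v.
Proof.
have -> : v + v = of_real k 2 *: v.
  rewrite -[v in LHS]scale1r -scalerDl; congr (_ *: _).
  by apply: (@scalar_eqP R k); rewrite !scalarE; lra.
by rewrite row_normZ modulus_of_real ger0_norm // mulr_natl mulr2n.
Qed.

Lemma row_normD u v : row_norm (u + v) <= row_norm u + row_norm v.
Proof.
apply/bigmax_leP; split=> [|j _]; first by rewrite addr_ge0 ?row_norm_ge0.
by apply: le_trans (rowsumD _ _ _) _; rewrite lerD ?rowsum_le_norm.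
Qed.

Lemma row_norm_tea j u v :
  (forall j', rowsum u j' <= rowsum u j) ->
  (forall j', rowsum v j' <= rowsum v j) ->
  rowsum (u + v) j = rowsum u j + rowsum v j ->
  row_norm (u + v) = row_norm u + row_norm v.
Proof.
move=> uj vj uvj; rewrite (row_norm_eq uj) (row_norm_eq vj) -uvj.
apply: row_norm_eq => j'; rewrite uvj.
by apply: le_trans (rowsumD _ _ _) _; rewrite lerD.
Qed.

(** The functional is explicit: weight the entries of a row in which v attains its norm by unit
    scalars that make the entries of v non-negative. *)
Lemma row_norm_support v : (0 < a)%N -> exists f : V -> F,
  [/\ forall c x y, f (c *: x + y) = c * f x + f y,
      forall x, modulus (f x) <= row_norm x & modulus (f v) = row_norm v].
Proof.
move=> a0; have [j vj] := row_norm_attained v a0.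
have phase i : {w : F | modulus w = 1 & w * v j i = of_real k (modulus (v j i))}.
  by apply: cid2; exact: modulus_phase.
pose w i := s2val (phase i).
have w1 i : modulus (w i) = 1 := s2valP (phase i).
have wv i : w i * v j i = of_real k (modulus (v j i)) := s2valP' (phase i).
exists (fun x => \sum_i w i * x j i); split=> [c x y|x|].
- rewrite mulr_sumr -big_split; apply: eq_bigr => i _ /=.
  by rewrite !mxE mulrDr mulrCA.
- apply: le_trans (rowsum_le_norm x j); apply: le_trans (modulus_sum _) _.
  by apply: ler_sum => i _; rewrite modulusM w1 mul1r.
- under eq_bigr do rewrite wv.
  have of_real_sum : of_real k (rowsum v j) = \sum_i of_real k (modulus (v j i)).
    rewrite /rowsum; elim/big_rec2: _ => [|i x y _ <-]; last by rewrite of_realD.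
    by apply: scalar_eqP; rewrite !scalarE.
  by rewrite -of_real_sum modulus_of_real ger0_norm ?rowsum_ge0.
Qed.

End RowNorm.

(** * Seminorms with common supporting functionals *)

Section Seminorm.
Variables (R : realType) (k : scalar_kind) (a b : nat).
Local Notation F := (scalar_field R k).
Local Notation V := 'M[F]_(a, b).
Variable M : V -> R.
Hypothesis MZ : forall (c : F) (v : V), M (c *: v) = modulus c * M v.
Hypothesis MD : forall u v : V, M (u + v) <= M u + M v.

Definition supports (f : V -> F) :=
  (forall c x y, f (c *: x + y) = c * f x + f y) /\
  (forall x, modulus (f x) <= M x).

(** For M v = N (T v) this is what the preservation hypothesis provides: f is the pull-back along T
    of a functional supporting the sum of the parallel images, suitably rotated. *)
Hypothesis M_tea : forall u v : V,
  row_norm (u + v) = row_norm u + row_norm v ->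
  exists f, [/\ supports f, modulus (f u) = M u & modulus (f v) = M v].

Implicit Types (u x y z e : V) (j : 'I_a) (p q t : F).

Lemma seminormN v : M (- v) = M v.
Proof. by rewrite -scaleN1r MZ modulusN modulus1 mul1r. Qed.

Lemma seminorm0 : M 0 = 0.
Proof. by rewrite -(scale0r 0) MZ modulus0 mul0r. Qed.

Lemma seminorm_ge0 v : 0 <= M v.
Proof. by have := MD v (- v); rewrite subrr seminorm0 seminormN; lra. Qed.

Lemma seminormB u v : M u - M v <= M (u - v).
Proof. by have := MD (u - v) v; rewrite subrK; lra. Qed.

Lemma supports_affine f x z t : supports f -> f (x + t *: z) = f x + f z * t.
Proof. by case=> fL _; rewrite addrC fL addrC mulrC. Qed.

Lemma supportsZ f (v : F) :
  supports f -> modulus v = 1 -> supports (fun x => v * f x).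
Proof.
case=> fL fM v1; split=> [c x y|x]; first by rewrite fL mulrDr mulrCA.
by rewrite modulusM v1 mul1r.
Qed.

(** When M x is non-zero, the intercept p and the slope q are determined up to a common phase;
    fixing the slope makes the intercepts of different x comparable. *)
Definition affine_on x z p q :=
  forall t, modulus t <= 1 -> M (x + t *: z) = modulus (p + q * t).

Lemma affine_on0 x z p q : affine_on x z p q -> M x = modulus p.
Proof.
by move=> /(_ 0); rewrite modulus0 scale0r mulr0 !addr0 => -> //; rewrite ler01.
Qed.

Lemma affine_onZ x z p q v :
  modulus v = 1 -> affine_on x z p q -> affine_on x z (v * p) (v * q).
Proof. by move=> v1 A t /A ->; rewrite -mulrA -mulrDr modulusM v1 mul1r. Qed.

Lemma affine_onZl x z p q v :
  modulus v = 1 -> affine_on x z p q -> affine_on (v *: x) z (v * p) q.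
Proof.
move=> v1 A t t1; have v0 := modulus1_neq0 v1.
have -> : v *: x + t *: z = v *: (x + (t / v) *: z).
  by rewrite scalerDr scalerA mulrCA divff // mulr1.
rewrite MZ A ?modulusM ?modulusV ?v1 ?divr1 // mul1r.
rewrite -[LHS]mul1r -v1 -modulusM mulrDr; congr (modulus (_ + _)).
by rewrite mulrCA [v * _]mulrC divfK.
Qed.

(** All x + t z with |t| <= 1 attain their norm in row j, where they coincide. Any two of them thus
    attain the triangle equality, and the common supporting functionals are the pairs that
    [affine_disc] asks for. *)
Lemma affine_on_row j x z : off_row j z ->
  (forall j', j' != j -> rowsum x j' + rowsum z j' <= rowsum x j) ->
  exists p q, affine_on x z p q.
Proof.
move=> zj xz; apply: (@affine_disc _ _ (fun t => M (x + t *: z)) (M z)) => [s t|s t s1 t1].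
  have := seminormB (x + s *: z) (x + t *: z).
  by rewrite opprD addrACA subrr add0r -scalerBl MZ mulrC.
have sumE r : rowsum (x + r *: z) j = rowsum x j.
  by rewrite rowsumD_off //; exact: off_rowZ.
have dom r : modulus r <= 1 -> forall j', rowsum (x + r *: z) j' <= rowsum (x + r *: z) j.
  move=> r1 j'; rewrite sumE; have [->|jj'] := eqVneq j' j; first by rewrite sumE.
  apply: le_trans (xz _ jj'); apply: le_trans (rowsumD _ _ _) _.
  by rewrite lerD2l rowsumZ ler_piMl ?rowsum_ge0.
have [|f [fS fs ft]] := M_tea (_ : row_norm ((x + s *: z) + (x + t *: z)) = _).
  apply: (row_norm_tea (dom s s1) (dom t t1)).
  rewrite !sumE addrACA -scalerDl rowsumD_off ?rowsum_double //.
  exact: off_rowZ.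
exists (f x), (f z); rewrite -!supports_affine // fs ft; split=> // w.
by rewrite -supports_affine //; case: fS.
Qed.

(** On the disc the modulus of f is dominated by |p + q t| and touches it at t = 0, so tangency
    applies. *)
Lemma support_affine_on x z p q f :
    affine_on x z p q -> M x != 0 -> supports f -> modulus (f x) = M x ->
  exists2 v : F, modulus v = 1 & f x = v * p /\ f z = v * q.
Proof.
move=> A x0 fS fx; apply: (tangent_affine _ ltr01).
- by rewrite -modulus_eq0 -(affine_on0 A).
- by rewrite fx (affine_on0 A).
- move=> t t1; rewrite -supports_affine // -A //; by case: fS.
Qed.

(** Both slopes are, up to a phase, the value at z of one functional supporting x and x'; a rotation
    makes them equal. *)
Lemma affine_on_transfer x x' z p q p' q' :
    row_norm (x + x') = row_norm x + row_norm x' ->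
    affine_on x z p q -> affine_on x' z p' q' -> M x != 0 -> M x' != 0 ->
  exists2 p'', modulus p'' = modulus p' & affine_on x' z p'' q.
Proof.
move=> xx' A A' x0 x'0; have [f [fS fx fx']] := M_tea xx'.
have [v v1 [_ fz]] := support_affine_on A x0 fS fx.
have [w w1 [_]] := support_affine_on A' x'0 fS fx'.
rewrite fz => vw; have v0 := modulus1_neq0 v1.
exists (w / v * p'); first by rewrite !modulusM modulusV w1 v1 divr1 mul1r.
have -> : q = w / v * q' by rewrite mulrAC -vw mulrC mulKf.
by apply: affine_onZ => //; rewrite modulusM modulusV w1 v1 divr1.
Qed.

(** The phases relating the functional to the two pairs agree because both carry the non-zero q to
    the same value at z. *)
Lemma common_support x x' z p p' q :
    row_norm (x + x') = row_norm x + row_norm x' ->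
    affine_on x z p q -> affine_on x' z p' q -> M x != 0 -> M x' != 0 -> q != 0 ->
  exists f, [/\ supports f, f x = p & f x' = p'].
Proof.
move=> xx' A A' x0 x'0 q0; have [f [fS fx fx']] := M_tea xx'.
have [v v1 [fxE fz]] := support_affine_on A x0 fS fx.
have [w w1 [fx'E]] := support_affine_on A' x'0 fS fx'.
rewrite fz => /(mulIf q0) vw; have v0 := modulus1_neq0 v1.
exists (fun y => v^-1 * f y); rewrite fxE fx'E -vw !mulKf //; split=> //.
by apply: supportsZ; rewrite // modulusV v1 invr1.
Qed.

(* Adding a large multiple of w to s does not change M and makes the disc in the
   direction of a large multiple of z admissible; on that disc M (s + t z) = |p + q t|
   with |p| <= |q|, which has a zero. *)
Lemma kernel_rank_one j w z : in_row j w -> w != 0 -> M w = 0 ->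
  off_row j z -> M z != 0 -> forall s, exists t, M (s + t *: z) = 0.
Proof.
move=> wj w0 Mw zj Mz0 s.
have Mz : 0 < M z by rewrite lt_def Mz0 seminorm_ge0.
have w_gt0 : 0 < rowsum w j.
  rewrite lt_def rowsum_ge0 andbT -(row_norm_in wj).
  by apply: contra w0 => /eqP/row_norm_eq0 ->.
(* The factor 3 gives |p + q| >= 3 M s - M y >= 2 |p| below, since |p| = M y <= M s; hence |q| >=
   |p|. *)
have [c c0 cE] : exists2 c, 0 <= c & c * M z = 3 * M s.
  exists (3 * M s / M z); last by rewrite divfK.
  by rewrite divr_ge0 ?mulr_ge0 ?seminorm_ge0.
(* Large enough that row j of s + d w dominates every other row of s + t c z, |t| <= 1, even after
   row j of s is subtracted. *)
have [d d0 dE] : exists2 d, 0 <= d &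
    d * rowsum w j = rowsum s j + row_norm s + c * row_norm z.
  exists ((rowsum s j + row_norm s + c * row_norm z) / rowsum w j).
    by rewrite divr_ge0 ?addr_ge0 ?mulr_ge0 ?rowsum_ge0 ?row_norm_ge0.
  by rewrite divfK ?gt_eqF.
pose y := s + of_real k d *: w.
have [||p [q A]] := @affine_on_row j y (of_real k c *: z).
- exact: off_rowZ.
- move=> j' jj'.
  have -> : rowsum y j' = rowsum s j'.
    by rewrite rowsumD_off // => i; rewrite mxE wj // mulr0.
  have : rowsum (of_real k d *: w) j <= rowsum y j + rowsum (- s) j.
    by apply: le_trans (rowsumD _ _ _); rewrite addrAC subrr add0r.
  rewrite -scaleN1r !rowsumZ !modulus_of_real modulusN modulus1 mul1r !ger0_norm //.
  rewrite dE => h.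
  have := ler_wpM2l c0 (rowsum_le_norm z j').
  have := rowsum_le_norm s j'; lra.
have Mdw : M (of_real k d *: w) = 0 by rewrite MZ Mw mulr0.
have My : M y <= M s by have := MD s (of_real k d *: w); rewrite Mdw addr0.
have pE := affine_on0 A.
have := A 1; rewrite modulus1 lexx mulr1 scale1r => /(_ isT) A1.
have cz : M (of_real k c *: z) = 3 * M s.
  by rewrite MZ modulus_of_real ger0_norm.
have qp : modulus p <= modulus q.
  have := seminormB (of_real k c *: z) (- y); rewrite opprK seminormN [_ + y]addrC A1 cz.
  have := modulusD p q; lra.
have [t t1 Mt] : exists2 t, modulus t <= 1 & M (y + t *: (of_real k c *: z)) = 0.
  have [q0|q0] := eqVneq q 0.
    exists 0; rewrite ?modulus0 ?ler01 // scale0r addr0 pE.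
    by move: qp; rewrite q0 modulus0 => p0; apply/eqP; rewrite eq_le p0 modulus_ge0.
  exists (- p / q); last first.
    rewrite A; last first.
      by rewrite modulusM modulusV modulusN ler_pdivrMr ?modulus_gt0 // mul1r.
    by rewrite mulrC divfK // subrr modulus0.
  by rewrite modulusM modulusV modulusN ler_pdivrMr ?modulus_gt0 // mul1r.
exists (t * of_real k c); apply/eqP; rewrite eq_le seminorm_ge0 andbT.
have := MD (y + t *: (of_real k c *: z)) (- (of_real k d *: w)).
rewrite seminormN Mdw Mt /y scalerA; rewrite addrAC [s + _ - _]addrK; lra.
Qed.

(* With p' the intercept at e' for the common slope q, choose v with p + v p' = 0.
   If M did not vanish at the midpoint m of e and v e', then m would have an
   intercept r; supporting functionals at each two of e, m, v e' give
   |2 r - p| <= |v p'| and |2 r - v p'| <= |p|, whence r = (p + v p') / 2 = 0. *)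
Lemma kernel_of_affine_on j e e' z p q :
    in_row j e -> in_row j e' -> off_row j z ->
    row_norm z <= rowsum e j -> row_norm z <= rowsum e' j ->
    (forall v, modulus v = 1 -> rowsum (e + v *: e') j = rowsum e j + rowsum e' j) ->
    M e = M e' -> M e != 0 -> affine_on e z p q -> q != 0 ->
  exists2 v, modulus v = 1 & M (e + v *: e') = 0.
Proof.
move=> ej e'j zj ze ze' ee' MeE Me0 A q0.
have Me'0 : M e' != 0 by rewrite -MeE.
have on_row x : in_row j x -> row_norm z <= rowsum x j -> exists p q, affine_on x z p q.
  move=> xj zx; apply: affine_on_row zj _ => j' jj'.
  by rewrite (rowsum_in xj jj') add0r (le_trans (rowsum_le_norm _ _)).
have tea v : modulus v = 1 -> row_norm (e + v *: e') = row_norm e + row_norm (v *: e').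
  move=> v1; rewrite (row_norm_in (in_rowD ej (in_rowZ v e'j))) (row_norm_in ej).
  by rewrite (row_norm_in (in_rowZ v e'j)) rowsumZ v1 mul1r ee'.
have [p1 [q1 A1]] := on_row _ e'j ze'.
have [p' _ A'] : exists2 p'', modulus p'' = modulus p1 & affine_on e' z p'' q.
  apply: affine_on_transfer A A1 Me0 Me'0.
  by have := tea 1 (modulus1 _ _); rewrite scale1r.
have p'0 : p' != 0 by rewrite -modulus_eq0 -(affine_on0 A').
pose v := - p / p'.
have v1 : modulus v = 1.
  by rewrite modulusM modulusV modulusN -(affine_on0 A) -(affine_on0 A') MeE divff.
have vp' : v * p' = - p by rewrite divfK.
exists v => //; apply/eqP; apply: contraT => Mev0.
set e'' := v *: e' in Mev0 *.
have e''j : in_row j e'' by exact: in_rowZ.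
have A'' : affine_on e'' z (- p) q by rewrite -vp'; exact: affine_onZl.
have Me''E : M e'' = M e' by rewrite MZ v1 mul1r.
have Me''0 : M e'' != 0 by rewrite Me''E.
pose h : F := of_real k 2^-1.
have mh : modulus h = 2^-1 by rewrite modulus_of_real ger0_norm // invr_ge0.
pose m := h *: (e + e'').
have mj : in_row j m by apply: in_rowZ; exact: in_rowD.
have e''S : rowsum e'' j = rowsum e' j by rewrite rowsumZ v1 mul1r.
have mS : rowsum m j = (rowsum e j + rowsum e' j) / 2.
  by rewrite rowsumZ mh ee' // mulrC.
have Mm0 : M m != 0 by rewrite MZ mh mulf_neq0 // invr_eq0.
have hh : h + h = 1 by apply: scalar_eqP; rewrite !scalarE; lra.
have mid x y : x + y = e + e'' -> in_row j x ->
    rowsum (x + y) j = rowsum x j + rowsum y j ->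
    row_norm (m + x) = row_norm m + row_norm x.
  move=> xyE xj xy.
  rewrite (row_norm_in (in_rowD mj xj)) (row_norm_in mj) (row_norm_in xj).
  by rewrite /m -xyE rowsum_midpoint.
have ee''S : rowsum (e + e'') j = rowsum e j + rowsum e'' j by rewrite ee' // e''S.
have tea_e := mid e e'' erefl ej ee''S.
have e''eS : rowsum (e'' + e) j = rowsum e'' j + rowsum e j.
  by rewrite [e'' + e]addrC ee''S addrC.
have tea_e'' := mid e'' e (addrC _ _) e''j e''eS.
have [|p2 [q2 A2]] := on_row _ mj; first by rewrite mS; lra.
have [r _ Am] : exists2 r, modulus r = modulus p2 & affine_on m z r q.
  apply: affine_on_transfer A A2 Me0 Mm0.
  by rewrite addrC tea_e addrC.
have [f [fS fm fe]] := common_support tea_e Am A Mm0 Me0 q0.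
have [g [gS gm ge]] := common_support tea_e'' Am A'' Mm0 Me''0 q0.
(* As m is the midpoint of x and y, the value of l at y = 2 m - x is read off from its values at m
   and x. *)
have reflect l x y r' s' : supports l -> x + y = e + e'' -> l m = r' -> l x = s' ->
    modulus (r' + r' - s') <= M y.
  case=> lL lM xyE <- <-; suff -> : l m + l m - l x = l y by exact: lM.
  have mmE : m + m = x + y by rewrite xyE -scalerDl hh scale1r.
  have lD u w : l (u + w) = l u + l w by rewrite -[u in LHS]scale1r lL mul1r.
  by rewrite -lD mmE lD addrAC subrr add0r.
have hf := reflect _ _ _ _ _ fS erefl fm fe.
have hg := reflect _ _ _ _ _ gS (addrC _ _) gm ge.
(* The left side is -2 r and |r| = M m. In [midpoint_modulus] take a = r, b = p - r and b' = -p - r;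
   then a + (b + b') / 2 = 0. *)
suff : (p - r) + (- p - r) = 0.
  rewrite addrACA subrr add0r -opprD => /eqP; rewrite oppr_eq0 => r0.
  have : modulus (r + r) = 0 by rewrite (eqP r0) modulus0.
  by rewrite modulus_double -(affine_on0 Am) => /eqP; rewrite -mulr2n mulrn_eq0 (negPf Mm0).
apply: (@midpoint_modulus _ _ r).
- by rewrite opprB addrA [r + (- p - r)]addrC subrK modulusN -(affine_on0 A) MeE -Me''E.
- by rewrite opprB addrA [r + (p - r)]addrC subrK -(affine_on0 A).
- rewrite addrACA subrr add0r -opprD mulrN mulrDr -mulrDl hh mul1r subrr.
  by rewrite modulus0 modulus_ge0.
Qed.

(** A zero slope gives the claim. A non-zero slope is transferred from x to a multiple e of a basis
    vector of the row; with a multiple e' of a second basis vector, [kernel_of_affine_on] produces a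
    non-zero vector of the row on which M vanishes. *)
Lemma seminorm_row_dominates j x z (i0 i1 : 'I_b) : i0 != i1 ->
    (forall y, in_row j y -> M y = 0 -> y = 0) ->
    in_row j x -> off_row j z -> row_norm z <= rowsum x j ->
  M (x + z) = M x.
Proof.
move=> i01 inj xj zj zx.
have r0 : 0 <= rowsum x j := rowsum_ge0 x j.
have [rx0|rx0] := eqVneq (rowsum x j) 0.
  suff -> : z = 0 by rewrite addr0.
  by apply: row_norm_eq0; apply/eqP; rewrite eq_le row_norm_ge0 andbT -rx0.
have Mx0 : M x != 0.
  apply: contra rx0 => /eqP/(inj _ xj) ->; apply/eqP/rowsum_off => i.
  by rewrite mxE.
have [|p [q A]] := @affine_on_row j x z zj.
  by move=> j' jj'; rewrite (rowsum_in xj jj') add0r (le_trans (rowsum_le_norm _ _)).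
have [q0|q0] := eqVneq q 0.
  rewrite (affine_on0 A) -[z]scale1r A ?modulus1 //.
  by rewrite q0 mul0r addr0.
exfalso.
have i10 : i1 != i0 by rewrite eq_sym.
pose d i : V := delta_mx j i.
have dj i : in_row j (d i) := @in_row_delta R k a b j i.
have d0 i : d i != 0 := @delta_mx_neq0 R k a b j i.
have Md i : 0 < M (d i).
  by rewrite lt_def seminorm_ge0 andbT; apply: contra (d0 i) => /eqP/(inj _ (dj i)) ->.
have dS c i : rowsum (c *: d i) j = modulus c := rowsum_delta c j i.
(* The phase u aligns e with the entry of x at [i0], so that x and e attain the triangle
   equality. *)
have [u u1 ux] := modulus_phase (x j i0); have u0 := modulus1_neq0 u1.
(* Both constants are at least the row sum of x, and both products c0 M (d i0) and c1 M (d i1) equal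
   that row sum times M (d i0) + M (d i1). *)
pose c0 := rowsum x j * (1 + M (d i1) / M (d i0)).
pose c1 := rowsum x j * (1 + M (d i0) / M (d i1)).
have c0r : rowsum x j <= c0.
  by rewrite ler_peMr // lerDl divr_ge0 // ltW.
have c1r : rowsum x j <= c1.
  by rewrite ler_peMr // lerDl divr_ge0 // ltW.
have c01 : c0 * M (d i0) = c1 * M (d i1).
  by rewrite /c0 /c1; field; rewrite !gt_eqF.
clearbody c0 c1.
pose e := (u^-1 * of_real k c0) *: d i0.
pose e' := of_real k c1 *: d i1.
have ej : in_row j e by exact: in_rowZ.
have e'j : in_row j e' by exact: in_rowZ.
have eS : rowsum e j = c0.
  by rewrite dS modulusM modulusV u1 invr1 mul1r modulus_of_real ger0_norm //; lra.
have e'S : rowsum e' j = c1 by rewrite dS modulus_of_real ger0_norm //; lra.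
have Me : M e = c0 * M (d i0).
  by rewrite MZ modulusM modulusV u1 invr1 mul1r modulus_of_real ger0_norm //; lra.
have Me' : M e' = c1 * M (d i1) by rewrite MZ modulus_of_real ger0_norm //; lra.
have c0_gt0 : 0 < c0 by rewrite (lt_le_trans _ c0r) // lt_def rx0.
have Me0 : M e != 0 by rewrite Me mulf_neq0 // gt_eqF.
have xe : rowsum (x + e) j = rowsum x j + rowsum e j.
  rewrite eS /rowsum [LHS](bigD1 i0) //= [\sum_i modulus (x j i)](bigD1 i0) //=.
  rewrite !mxE !eqxx mulr1.
  have -> : modulus (x j i0 + u^-1 * of_real k c0) = modulus (x j i0) + c0.
    rewrite -[LHS]mul1r -u1 -modulusM mulrDr ux mulVKf // -of_realD.
    by rewrite modulus_of_real ger0_norm // addr_ge0 ?modulus_ge0 // ltW.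
  rewrite addrAC; congr (_ + _ + _); apply: eq_bigr => i ii0.
  by rewrite !mxE (negPf ii0) andbF mulr0 addr0.
have [|p1 [q1 A1]] := @affine_on_row j e z zj.
  move=> j' jj'; rewrite (rowsum_in ej jj') add0r eS.
  by apply: le_trans (rowsum_le_norm _ _) _; lra.
have tea_xe : row_norm (x + e) = row_norm x + row_norm e.
  by rewrite (row_norm_in (in_rowD xj ej)) (row_norm_in xj) (row_norm_in ej).
have [p2 _ A2] := affine_on_transfer tea_xe A A1 Mx0 Me0.
have ze : row_norm z <= rowsum e j by rewrite eS; lra.
have ze' : row_norm z <= rowsum e' j by rewrite e'S; lra.
have ee' w : modulus w = 1 -> rowsum (e + w *: e') j = rowsum e j + rowsum e' j.
  move=> w1; rewrite e'S eS /rowsum (bigD1 i0) //= (bigD1 i1) 1?eq_sym //= big1.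
    2: move=> i /andP[/negPf ii0 /negPf ii1].
    2: by rewrite !mxE ii0 ii1 !andbF !mulr0 addr0 modulus0.
  rewrite !mxE !eqxx (negPf i01) (negPf i10) !andbF !mulr0 !mulr1 add0r !addr0.
  rewrite !modulusM modulusV u1 w1 invr1 !mul1r !modulus_of_real !ger0_norm //; lra.
have Mee' : M e = M e' by rewrite Me Me' c01.
have [v v1 Mv] := kernel_of_affine_on ej e'j zj ze ze' ee' Mee' Me0 A2 q0.
have := inj _ (in_rowD ej (in_rowZ v e'j)) Mv.
move/matrixP/(_ j i0)/eqP; rewrite !mxE !eqxx (negPf i01) andbF !mulr0 addr0 mulr1.
by rewrite mulf_eq0 invr_eq0 (negPf u0) of_real_eq0 gt_eqF.
Qed.

(** The cases are whether M kills a non-zero vector lying in one row. The second alternative is rank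
    one in terms of M: for M = N (T v) it puts the range of T in the line of T z. *)
Theorem seminorm_tea_dichotomy (ha : (1 < a)%N) (hb : (1 < b)%N) :
  (exists c, forall v : V, M v = c * row_norm v) \/
  (exists z : V, forall s, exists t, M (s + t *: z) = 0).
Proof.
have row_split j (v : V) : exists x z, [/\ in_row j x, off_row j z & v = x + z].
  exists (\matrix_(j', i) if j' == j then v j' i else 0).
  exists (\matrix_(j', i) if j' == j then 0 else v j' i).
  split=> [j' i /negPf jj'|i|]; rewrite ?mxE ?jj' ?eqxx //.
  by apply/matrixP => j' i; rewrite !mxE; case: ifP; rewrite ?addr0 ?add0r.
have off_neq j j' x : in_row j' x -> j' != j -> off_row j x.
  by move=> xj' jj' i; apply: xj'; rewrite eq_sym.
pose j0 : 'I_a := Ordinal (ltnW ha); pose j1 : 'I_a := Ordinal ha.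
pose i0 : 'I_b := Ordinal (ltnW hb); pose i1 : 'I_b := Ordinal hb.
have other j : exists j', j' != j.
  have [->|] := eqVneq j j0; first by exists j1.
  by exists j0; rewrite eq_sym.
have [[j [w [wj w0 Mw]]]|noker] :=
    pselect (exists j w, [/\ in_row j w, w != 0 & M w = 0]).
  have [[z zj /eqP Mz]|Mz] := pselect (exists2 z, off_row j z & M z <> 0).
    by right; exists z; exact: kernel_rank_one wj w0 Mw zj Mz.
  have off0 z : off_row j z -> M z = 0.
    by move=> zj; apply: contrapT => Mz0; apply: Mz; exists z.
  have [j' jj'] := other j.
  pose w' : V := delta_mx j' i0.
  have w'j : in_row j' w' := @in_row_delta R k a b j' i0.
  have w'0 : w' != 0 := @delta_mx_neq0 R k a b j' i0.
  have Mw' : M w' = 0 by apply: off0; exact: off_neq w'j jj'.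
  have [[z zj' /eqP Mz']|Mz'] := pselect (exists2 z, off_row j' z & M z <> 0).
    by right; exists z; exact: kernel_rank_one w'j w'0 Mw' zj' Mz'.
  (* Now M vanishes off row j and off row j', and the part of v in row j lies off row j', so M =
     0. *)
  left; exists 0 => v; rewrite mul0r; have [x [z [xj zj ->]]] := row_split j v.
  apply/eqP; rewrite eq_le seminorm_ge0 andbT; apply: le_trans (MD _ _) _.
  rewrite (off0 z zj) addr0 le_eqVlt; apply/orP; left; apply/eqP; apply: contrapT => Mx.
  by apply: Mz'; exists x => //; apply: off_neq xj _; rewrite eq_sym.
have inj j y : in_row j y -> M y = 0 -> y = 0.
  move=> yj My; apply/eqP; apply: contrapT => y0; apply: noker.
  by exists j, y; split=> //; apply/negP.
have i01 : i0 != i1 by [].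
have dom j x z := @seminorm_row_dominates j x z i0 i1 i01 (inj j).
(* Each of x and y dominates the other, so M x = M (x + y) = M y. *)
have same j j' x y : j != j' -> in_row j x -> in_row j' y ->
    rowsum x j = rowsum y j' -> M x = M y.
  move=> jj' xj yj' xy.
  rewrite -(dom j x y) // ?(row_norm_in yj') ?xy //; last first.
    by apply: off_neq yj' _; rewrite eq_sym.
  rewrite addrC (dom j' y x) // ?(row_norm_in xj) ?xy //; exact: off_neq xj _.
pose d j : V := delta_mx j i0.
have dj j : in_row j (d j) := @in_row_delta R k a b j i0.
have dS c j : rowsum (c *: d j) j = modulus c := rowsum_delta c j i0.
left; exists (M (d j0)) => v.
have [j vj] := row_norm_attained v (ltnW ha).
have [x [z [xj zj vE]]] := row_split j v.
have xv : rowsum x j = row_norm v by rewrite vj vE rowsumD_off.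
have zv : row_norm z <= rowsum x j.
  apply/bigmax_leP; split=> [|j' _]; first exact: rowsum_ge0.
  have [->|jj'] := eqVneq j' j; first by rewrite rowsum_off ?rowsum_ge0.
  by rewrite xv -(rowsumD_off z (off_neq _ _ _ xj _)) 1?eq_sym // addrC -vE rowsum_le_norm.
rewrite {1}vE (dom _ _ _ xj zj zv).
have v0 := row_norm_ge0 v.
(* [same] compares distinct rows only, so row [j0] is compared with itself through [j1]. *)
have [j1E|jj1] := eqVneq j j0.
  rewrite j1E in xj xv.
  have -> : M x = M (of_real k (row_norm v) *: d j1).
    apply: (same j0 j1) => //; first exact: in_rowZ.
    by rewrite xv dS modulus_of_real ger0_norm.
  rewrite MZ modulus_of_real ger0_norm // mulrC; congr (_ * _).
  rewrite -[d j1]scale1r -[d j0]scale1r; apply: (same j1 j0); rewrite // ?dS //.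
    exact: in_rowZ.
  exact: in_rowZ.
rewrite (same j j0 x (of_real k (row_norm v) *: d j0)) //.
- by rewrite MZ modulus_of_real ger0_norm // mulrC.
- exact: in_rowZ.
- by rewrite xv dS modulus_of_real ger0_norm.
Qed.

End Seminorm.

(** * Preservers *)

Section Preservers.
Variables (R : realType) (k : scalar_kind) (a b : nat).
Hypotheses (a_gt1 : (1 < a)%N) (b_gt1 : (1 < b)%N).
Local Notation F := (scalar_field R k).
(** An abstract [coord] covers both values of p: its rows are the columns of the operator's matrix
    for p = 1 and the rows for p = oo. *)
Variables (W : vectType F) (N : W -> R) (coord : W -> 'M[F]_(a, b)).
Hypothesis coord_linear : forall (c : F) x y,
  coord (c *: x + y) = c *: coord x + coord y.
Hypothesis coord_bij : bijective coord.
Hypothesis normE : forall x, N x = row_norm (coord x).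
Variable T : 'End(W).
Hypothesis T_neq0 : T <> 0.
Implicit Types (x y w : W).

Let coord0 : coord 0 = 0.
Proof.
have := coord_linear 1 0 0; rewrite scaler0 addr0 scale1r => /eqP.
by rewrite -subr_eq0 opprD addrA subrr sub0r oppr_eq0 => /eqP.
Qed.

Let coordZ c x : coord (c *: x) = c *: coord x.
Proof. by have := coord_linear c x 0; rewrite !addr0 coord0 addr0. Qed.

Let coordD x y : coord (x + y) = coord x + coord y.
Proof. by have := coord_linear 1 x y; rewrite !scale1r. Qed.

Let normZ (c : F) x : N (c *: x) = modulus c * N x.
Proof. by rewrite !normE coordZ row_normZ. Qed.

Let normD x y : N (x + y) <= N x + N y.
Proof. by rewrite !normE coordD row_normD. Qed.

Let norm0 : N 0 = 0.
Proof. by rewrite -(scale0r 0) normZ modulus0 mul0r. Qed.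

Let norm_eq0 x : N x = 0 -> x = 0.
Proof.
rewrite normE => /row_norm_eq0 x0; case: coord_bij => g gK _.
by rewrite -(gK x) x0 -coord0 gK.
Qed.

Let norm_neq0 x : x != 0 -> N x != 0.
Proof. by apply: contra => /eqP/norm_eq0 ->. Qed.

(** The seminorm dichotomy is applied to the norm of the image under T. *)
Lemma parallel_preserver_dichotomy :
    (forall x y, TEA_pair N x y -> parallel_pair N (T x) (T y)) ->
  (exists2 c, 0 < c & forall x, N (T x) = c * N x) \/ (\dim (limg T) <= 1)%N.
Proof.
move=> T_par; have [g gK Kg] := coord_bij.
have gL (c : F) u v : g (c *: u + v) = c *: g u + g v.
  by apply: (can_inj gK); rewrite coord_linear !Kg.
have g0 : g 0 = 0 by rewrite -coord0 gK.
have gZ (c : F) u : g (c *: u) = c *: g u.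
  by have := gL c u 0; rewrite !addr0 g0 addr0.
have gD u v : g (u + v) = g u + g v by have := gL 1 u v; rewrite !scale1r.
pose M u := N (T (g u)).
have MZ (c : F) u : M (c *: u) = modulus c * M u by rewrite /M gZ linearZ normZ.
have MD u v : M (u + v) <= M u + M v by rewrite /M gD linearD normD.
have M_tea u v : row_norm (u + v) = row_norm u + row_norm v ->
    exists f, [/\ supports M f, modulus (f u) = M u & modulus (f v) = M v].
  move=> uv; have [|l l1 luv] := T_par (g u) (g v).
    by rewrite /TEA_pair -gD !normE !Kg.
  rewrite addrC in luv.
  (* The triangle equality leaves no slack: a functional supporting the sum attains the norm of each
     summand, hence so does its pull-back [h]. *)
  have [f [fL fle]] := row_norm_support (coord (l *: T (g v) + T (g u))) (ltnW a_gt1).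
  rewrite -normE luv coord_linear fL => fS.
  pose h v0 := f (coord (T (g v0))).
  have hL (c : F) v0 v1 : h (c *: v0 + v1) = c * h v0 + h v1.
    by rewrite /h gL linearP coord_linear fL.
  have hle v0 : modulus (h v0) <= M v0 by rewrite /M normE fle.
  have := modulusD (l * h v) (h u); rewrite fS modulusM l1 mul1r.
  have := hle u; have := hle v; rewrite /M => hu hv huv.
  by exists h; split; [split| |]; rewrite // /M; lra.
have [[c cM]|[z zM]] := seminorm_tea_dichotomy MZ MD M_tea a_gt1 b_gt1.
  have cN x : N (T x) = c * N x by rewrite [N x]normE -cM /M gK.
  left; exists c => //.
  have [x Tx] : exists x, T x <> 0.
    apply: contrapT => T0; apply: T_neq0; apply/lfunP => x; rewrite zero_lfunE.
    by apply: contrapT => Tx; apply: T0; exists x.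
  have NTx : 0 < N (T x).
    by rewrite lt_def norm_neq0 /=; [rewrite normE row_norm_ge0|exact/eqP].
  rewrite ltNge; apply/negP => c0; move: NTx.
  by rewrite cN ltNge mulr_le0_ge0 // normE row_norm_ge0.
right; rewrite (leq_trans (dimvS (_ : (limg T <= <[T (g z)]>)%VS))) //.
  apply/subvP => _ /memv_imgP[x _ ->]; apply/vlineP.
  have [t] := zM (coord x); rewrite /M gD gZ gK => /norm_eq0.
  rewrite linearD linearZ => /eqP; rewrite addr_eq0 -scaleNr => /eqP Tx.
  by exists (- t).
by rewrite dim_vline leq_b1.
Qed.

(** Some basis vector e has T e non-zero. Two basis vectors of another row are both sent into the
    line of T e, so a non-trivial combination w of them is killed. *)
Lemma rank_le1_kernel : (\dim (limg T) <= 1)%N ->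
  exists j w e,
    [/\ in_row j (coord w), off_row j (coord e), w != 0, T w = 0 & T e != 0].
Proof.
move=> rkT; have [g gK Kg] := coord_bij.
pose d j i := g (delta_mx j i).
have [[j' i] /eqP Te] : exists ji, T (d ji.1 ji.2) <> 0.
  apply: contrapT => T0; apply: T_neq0; apply/lfunP => x; rewrite zero_lfunE.
  have -> : x = \sum_j \sum_i coord x j i *: d j i.
    apply: (can_inj gK); rewrite [LHS]matrix_sum_delta.
    rewrite (big_morph coord coordD coord0); apply: eq_bigr => j _.
    rewrite (big_morph coord coordD coord0); apply: eq_bigr => i _.
    by rewrite coordZ Kg.
  rewrite linear_sum big1 // => j _; rewrite linear_sum big1 // => i _.
  rewrite linearZ /=; suff -> : T (d j i) = 0 by rewrite scaler0.
  by apply: contrapT => Td; apply: T0; exists (j, i).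
rewrite /= in Te.
have [j jj'] : exists j, j' != j.
  pose j0 : 'I_a := Ordinal (ltnW a_gt1); pose j1 : 'I_a := Ordinal a_gt1.
  by have [->|] := eqVneq j' j0; [exists j1|exists j0].
have line x : exists c, T x = c *: T (d j' i).
  apply/vlineP; suff /eqP -> : <[T (d j' i)]>%VS == limg T by exact: memv_img (memvf x).
  by rewrite eqEdim dim_vline Te rkT andbT -memvE memv_img // memvf.
pose i0 : 'I_b := Ordinal (ltnW b_gt1); pose i1 : 'I_b := Ordinal b_gt1.
have [c0 T0] := line (d j i0); have [c1 T1] := line (d j i1).
have d_in i' : in_row j (coord (d j i')).
  by rewrite Kg; exact: in_row_delta.
have off : off_row j (coord (d j' i)) by move=> i'; rewrite Kg mxE eq_sym (negPf jj').
have nz x i' : coord x j i' != 0 -> x != 0.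
  by apply: contra => /eqP ->; rewrite coord0 mxE.
have [c00|c00] := eqVneq c0 0.
  exists j, (d j i0), (d j' i); split=> //; last by rewrite T0 c00 scale0r.
  by apply: (nz _ i0); rewrite Kg mxE !eqxx oner_eq0.
exists j, (c1 *: d j i0 + (- c0) *: d j i1), (d j' i); split=> //.
- by rewrite coordD !coordZ; apply: in_rowD; apply: in_rowZ.
- apply: (nz _ i1); rewrite coordD !coordZ !mxE !Kg !mxE !eqxx.
  by rewrite andbF mulr0 add0r mulr1 oppr_eq0.
- by rewrite linearD !linearZ /= T0 T1 !scalerA mulNr scaleNr mulrC subrr.
Qed.

Theorem preservers_tfae :
  [<-> preserves_pairs (TEA_pair N) T;
       preserves_pairs (parallel_pair N) T /\ (1 < \dim (limg T))%N;
       preserves_pairs (parallel_pair N) T /\ bijective T;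
       exists (c : F) (U : 'End(W)), norm_isometry N U /\ T = c *: U].
Proof.
have TEA_parallel x y : TEA_pair N x y -> parallel_pair N x y.
  by move=> xy; exists 1; rewrite ?modulus1 // scale1r.
have scaled c : 0 < c -> (forall x, N (T x) = c * N x) ->
    exists (c : F) (U : 'End(W)), norm_isometry N U /\ T = c *: U.
  move=> c0 cN; exists (of_real k c), ((of_real k c)^-1 *: T).
  have rc0 : of_real k c != 0 by rewrite of_real_eq0 gt_eqF.
  split; last by rewrite scalerA divff // scale1r.
  move=> x; rewrite scale_lfunE normZ modulusV modulus_of_real gtr0_norm //.
  by rewrite cN mulKf // gt_eqF.
have rank_gt1 : bijective T -> (1 < \dim (limg T))%N.
  move=> /bij_inj T_inj; rewrite ltnNge; apply/negP => /rank_le1_kernel.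
  move=> [j [w [e [_ _ /eqP w0 Tw _]]]]; apply: w0; apply: T_inj.
  by rewrite Tw linear0.
have rank_iso : preserves_pairs (parallel_pair N) T -> (1 < \dim (limg T))%N ->
    exists2 c, 0 < c & forall x, N (T x) = c * N x.
  move=> T_par rkT.
  have T_tea_par x y : TEA_pair N x y -> parallel_pair N (T x) (T y).
    by move=> /TEA_parallel; exact: T_par.
  by have [//|] := parallel_preserver_dichotomy T_tea_par; rewrite leqNgt rkT.
tfae.
- move=> T_tea; split.
    (* Absorbing the unit scalar into y turns a parallel pair into a TEA pair. *)
    move=> x y [l l1 xy]; have := T_tea x (l *: y).
    rewrite /TEA_pair normZ l1 mul1r => /(_ xy); rewrite linearZ /= normZ l1 mul1r.
    by move=> Txy; exists l.
  rewrite ltnNge; apply/negP => /rank_le1_kernel[j [w [e [wj ej w0 Tw Te]]]].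
  have e0 : e != 0 by apply: contra Te => /eqP ->; rewrite linear0.
  have Ne0 := norm_neq0 e0.
  have Nw : N w = rowsum (coord w) j by rewrite normE (row_norm_in wj).
  (* Rescaled to the norm of w and lying in other rows, f makes w + f and w - f a TEA pair: both
     have norm N w and their sum is 2 w. Their images T f and - T f add up to 0 although T f is
     non-zero. *)
  pose f := of_real k (N w / N e) *: e.
  have fj : off_row j (coord f) by rewrite coordZ; exact: off_rowZ.
  have Nf : N f = N w.
    by rewrite normZ modulus_of_real ger0_norm ?divfK // divr_ge0 // normE row_norm_ge0.
  have Nwf l : modulus l = 1 -> N (w + l *: f) = N w.
    move=> l1; have jE : rowsum (coord (w + l *: f)) j = N w.
      by rewrite coordD coordZ Nw rowsumD_off //; exact: off_rowZ.
    rewrite normE (@row_norm_eq _ _ _ _ _ j) // => j'; rewrite jE.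
    have [->|jj'] := eqVneq j' j; first by rewrite jE.
    rewrite coordD; apply: le_trans (rowsumD _ _ _) _.
    by rewrite (rowsum_in wj jj') add0r -Nf -[N f]mul1r -l1 -normZ normE rowsum_le_norm.
  have N1 : modulus (-1 : F) = 1 by rewrite modulusN modulus1.
  have Nplus : N (w + f) = N w by have := Nwf 1; rewrite modulus1 scale1r; apply.
  have Nminus : N (w - f) = N w by rewrite -(Nwf _ N1) scaleN1r.
  have Nww : N (w + w) = N w + N w by rewrite normE coordD row_norm_double -normE.
  have := T_tea (w + f) (w - f); rewrite /TEA_pair Nplus Nminus.
  rewrite addrACA subrr addr0 Nww => /(_ erefl).
  have -> : T (w + f) = T f by rewrite linearD /= Tw add0r.
  have -> : T (w - f) = - T f by rewrite linearB /= Tw sub0r.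
  rewrite subrr norm0 -scaleN1r normZ N1 mul1r => /eqP; rewrite eq_sym -mulr2n mulrn_eq0 /=.
  move/eqP/norm_eq0/eqP; rewrite linearZ /= scaler_eq0 (negPf Te) orbF of_real_eq0.
  by rewrite mulf_eq0 invr_eq0 (negPf Ne0) (negPf (norm_neq0 w0)).
- move=> [T_par rkT]; split=> //; have [c c0 cN] := rank_iso T_par rkT.
  (* A positive multiple of the norm is preserved, so T is injective, hence bijective on a
     finite-dimensional space. *)
  have kerT : lker T == 0%VS.
    apply/lker0P => x y Txy; apply/eqP; rewrite -subr_eq0; apply/eqP/norm_eq0.
    apply: (mulfI (lt0r_neq0 c0)).
    by rewrite -cN linearB /= Txy subrr norm0 mulr0.
  exists (T^-1)%VF; [exact: lker0_lfunK|exact: lker0_lfunVK].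
- by move=> [T_par /rank_gt1 rkT]; have [c] := rank_iso T_par rkT; exact: scaled.
- move=> [c [U [U_iso ->]]] x y xy.
  by rewrite /TEA_pair !scale_lfunE -scalerDr -linearD !normZ !U_iso xy mulrDr.
Qed.

End Preservers.

(** * The operator norms *)

Lemma sup_eq_max (R : realType) (S : set R) (r : R) :
  (forall y, S y -> y <= r) -> (exists2 y, S y & r <= y) -> sup S = r.
Proof.
move=> Sr [y Sy ry]; apply/eqP; rewrite eq_le; apply/andP; split.
  by apply: sup_le_ub => //; exists y.
by apply: le_trans ry _; apply: ub_le_sup => //; exists r.
Qed.

Section OperatorNorm.
Variables (R : realType) (k : scalar_kind) (n m : nat).
Local Notation F := (scalar_field R k).
Implicit Types (A : 'Hom('cV[F]_n, 'cV[F]_m)) (x : 'cV[F]_n).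

(** The transpose of the usual matrix of A, so that [row_norm] sees the columns of that matrix. *)
Definition col_mx_of A : 'M[F]_(n, m) := \matrix_(j, i) A (delta_mx j 0) i 0.

Lemma col_mx_ofE A x i : A x i 0 = \sum_j x j 0 * col_mx_of A j i.
Proof.
rewrite {1}[x]matrix_sum_delta linear_sum summxE; apply: eq_bigr => j _.
by rewrite big_ord1 linearZ !mxE.
Qed.

Lemma col_mx_of_linear (c : F) A B :
  col_mx_of (c *: A + B) = c *: col_mx_of A + col_mx_of B.
Proof. by apply/matrixP => j i; rewrite !mxE add_lfunE scale_lfunE !mxE. Qed.

Lemma col_mx_of_bij : bijective col_mx_of.
Proof.
pose hom_of (B : 'M[F]_(n, m)) : 'Hom('cV[F]_n, 'cV[F]_m) := linfun (mulmx B^T).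
exists hom_of => [A|B].
  apply/lfunP => x; rewrite lfunE /=; apply/matrixP => i j; rewrite ord1.
  by rewrite col_mx_ofE mxE; apply: eq_bigr => l _; rewrite !mxE mulrC.
by apply/matrixP => j i; rewrite mxE lfunE /= -colE !mxE.
Qed.

Lemma lpnorm1E q (x : 'cV[F]_q) : lpnorm 1%:E x = \sum_i modulus (x i 0).
Proof.
rewrite /lpnorm invr1 powRr1.
  by apply: eq_bigr => i _; rewrite powRr1 // modulus_ge0.
by apply: sumr_ge0 => i _; rewrite powR_ge0.
Qed.

(** The supremum is attained at the basis vector of a column with largest l1-norm. *)
Lemma opnorm1E A : (0 < n)%N -> opnorm 1%:E A = row_norm (col_mx_of A).
Proof.
move=> n0; apply: sup_eq_max => [_ [x x1 <-]|].
  have {}x1 : lpnorm 1%:E x <= 1 := x1.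
  rewrite !lpnorm1E in x1 *.
  apply: (@le_trans _ _ (\sum_i \sum_j modulus (x j 0) * modulus (col_mx_of A j i))).
    apply: ler_sum => i _; rewrite col_mx_ofE; apply: le_trans (modulus_sum _) _.
    by apply: ler_sum => j _; rewrite modulusM.
  rewrite exchange_big /=.
  apply: (@le_trans _ _ (\sum_j modulus (x j 0) * row_norm (col_mx_of A))).
    apply: ler_sum => j _; rewrite -mulr_sumr ler_wpM2l ?modulus_ge0 //.
    exact: rowsum_le_norm.
  by rewrite -mulr_suml ler_piMl // row_norm_ge0.
have [j ->] := row_norm_attained (col_mx_of A) n0.
exists (lpnorm 1%:E (A (delta_mx j 0))).
  exists (delta_mx j 0) => //; change (lpnorm 1%:E (delta_mx j 0 : 'cV[F]_n) <= 1).
  rewrite lpnorm1E (bigD1 j) //= mxE !eqxx modulus1.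
  by rewrite big1 ?addr0 // => i ij; rewrite mxE (negPf ij) modulus0.
by rewrite lpnorm1E /rowsum; apply: ler_sum => i _; rewrite mxE.
Qed.

(** The supremum is attained at a vector of unit scalars that align the entries of a row with
    largest l1-norm. *)
Lemma opnorm_pinftyE A : (0 < m)%N -> opnorm +oo%E A = row_norm (col_mx_of A)^T.
Proof.
move=> m0; apply: sup_eq_max => [_ [x /= x1 <-]|].
  apply/bigmax_leP; split=> [|i _]; first exact: row_norm_ge0.
  rewrite col_mx_ofE; apply: le_trans (modulus_sum _) _.
  apply: le_trans (rowsum_le_norm _ i); apply: ler_sum => j _.
  rewrite modulusM [X in _ <= modulus X]mxE ler_piMl ?modulus_ge0 //.
  by apply: le_trans x1; exact: (le_bigmax_cond _ (fun j => modulus (x j 0))).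
have [i ->] := row_norm_attained (col_mx_of A)^T m0.
have phase j : {w : F | modulus w = 1 &
    w * col_mx_of A j i = of_real k (modulus (col_mx_of A j i))}.
  by apply: cid2; exact: modulus_phase.
pose x : 'cV[F]_n := \col_j s2val (phase j).
exists (lpnorm +oo%E (A x)).
  exists x => //=; apply/bigmax_leP; split=> // j _.
  by rewrite mxE (s2valP (phase j)).
apply: (@le_trans _ _ (modulus (A x i 0))); last first.
  exact: (le_bigmax_cond _ (fun i => modulus (A x i 0))).
apply: le_trans (re_le_modulus _); rewrite col_mx_ofE.
rewrite (big_morph (@scalar_re R k) (@scalar_reD R k) (@scalar_re0 R k)).
apply: ler_sum => j _.
by rewrite [x j 0]mxE (s2valP' (phase j)) re_of_real mxE.
Qed.

End OperatorNorm.

Theorem theorem1p1 (R : realType) (k : scalar_kind) (n m : nat) (p : \bar R)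
    (n_ge2 : (2 <= n)%N) (m_ge2 : (2 <= m)%N) (hp : p = 1%:E \/ p = +oo%E)
    (T : 'End('Hom('cV[scalar_field R k]_n, 'cV[scalar_field R k]_m))) (T_neq0 : T <> 0) :
  let N := @opnorm R k p n m in
  [<-> preserves_pairs (TEA_pair N) T;
       preserves_pairs (parallel_pair N) T /\ (1 < \dim (limg T))%N;
       preserves_pairs (parallel_pair N) T /\ bijective T;
       exists (c : scalar_field R k)
              (U : 'End('Hom('cV[scalar_field R k]_n, 'cV[scalar_field R k]_m))),
         norm_isometry N U /\ T = c *: U].
Proof.
move=> N; case: hp => hp.
  apply: (@preservers_tfae R k n m n_ge2 m_ge2 _ N (@col_mx_of R k n m)) => //.
  - exact: col_mx_of_linear.
  - exact: col_mx_of_bij.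
  - by move=> A; rewrite /N hp opnorm1E // ltnW.
(* For p = oo the transposition exchanges the roles of n and m. *)
apply: (@preservers_tfae R k m n m_ge2 n_ge2 _ N (fun A => (col_mx_of A)^T)) => //.
- by move=> c A B; rewrite col_mx_of_linear linearP.
- by apply: (bij_comp _ (@col_mx_of_bij R k n m)); exists trmx; exact: trmxK.
- by move=> A; rewrite /N hp opnorm_pinftyE // ltnW.
Qed.
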